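(* Let $(c_i)_{i\ge1}$ be nonnegative and nondecreasing, $\mu\in(0,1]$, $\beta\in(0,1)$, and $i\ge1$. Regarded as functions of the packet arrival probability $\lambda$, where $\lambda$ ranges over those values in $(0,1]$ for which $\sum_{j=1}^\infty c_j(1-\lambda\mu)^j<\infty$ (with $\mu$, $\beta$ and the costs held fixed), both the discounted Whittle index $m_{\beta,(1,i)}$ and the average Whittle index $m_{(1,i)}$ given in the context are nonincreasing in $\lambda$.
   Context: Put $p=\lambda\mu$ and $q=1-p$. For a single-user Age of Information model with packet arrival probability $\lambda$, transmission success probability $\mu$, discount factor $\beta$ and cost $c_i$ per slot at age $i$, the Whittle indices in state $(1,i)$ (packet available, age $i\ge1$) are as follows. Discounted criterion: $m_{\beta,(1,i)}=\mu\Big[\frac{\beta(1-\beta^i)(1-\beta q)}{1-\beta}\,C_{\beta,i+1}(q)-\sum_{j=1}^i\beta^jc_j\Big]$, where $C_{\beta,i}(q)=\sum_{j=1}^\infty(\beta q)^{j-1}c_{i-1+j}$ if $q>0$ and $C_{\beta,i}(0)=c_i$. Average criterion: $m_{(1,i)}=\mu\Big[i\,p\,C_{i+1}(q)-\sum_{j=1}^ic_j\Big]$, where $C_i(q)=\sum_{j=1}^\infty q^{j-1}c_{i-1+j}$ if $q>0$ and $C_i(0)=c_i$. *)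

(* Defs.v *)
From Stdlib Require Import Reals.
From Coquelicot Require Import Coquelicot.
Open Scope R_scope.

(* Costs are a function [c : nat -> R] of which only [c 1], [c 2], ... are
   meaningful; [c 0] is never used.  Series over j >= 1 are written with
   k = j - 1 >= 0. *)

(* C_{beta,i}(q) = sum_{j>=1} (beta q)^{j-1} c_{i-1+j} if q > 0, and
   C_{beta,i}(0) = c_i; here q = 1 - lam mu is always >= 0. *)
Definition C_disc (c : nat -> R) (beta : R) (i : nat) (q : R) : R :=
  if Rlt_dec 0 q
  then Series (fun k : nat => (beta * q) ^ k * c (i + k)%nat)
  else c i.

(* C_i(q) = sum_{j>=1} q^{j-1} c_{i-1+j} if q > 0, and C_i(0) = c_i. *)
Definition C_avg (c : nat -> R) (i : nat) (q : R) : R :=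
  if Rlt_dec 0 q
  then Series (fun k : nat => q ^ k * c (i + k)%nat)
  else c i.

Definition whittle_disc (c : nat -> R) (beta mu : R) (i : nat) (lam : R) : R :=
  let p := lam * mu in
  let q := 1 - p in
  mu * (beta * (1 - beta ^ i) * (1 - beta * q) / (1 - beta)
          * C_disc c beta (i + 1) q
        - sum_n_m (fun j : nat => beta ^ j * c j) 1 i).

Definition whittle_avg (c : nat -> R) (mu : R) (i : nat) (lam : R) : R :=
  let p := lam * mu in
  let q := 1 - p in
  mu * (INR i * p * C_avg c (i + 1) q - sum_n_m c 1 i).

(* For nonnegative costs, [ex_series] says that
   sum_{j>=1} c_j (1 - lam mu)^j is finite. *)
Definition admissible (c : nat -> R) (mu lam : R) : Prop :=
  0 < lam <= 1 /\
  ex_series (fun k : nat => c (k + 1)%nat * (1 - lam * mu) ^ (k + 1)).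

Definition nonincreasing_on (D : R -> Prop) (f : R -> R) : Prop :=
  forall x y : R, D x -> D y -> x <= y -> f y <= f x.

(* Main.v *)
(** With [r = beta q] (and [beta = 1] for the average criterion), both indices
    are, up to a nonnegative factor and a constant, [(1 - r) * sum_k r^k d_k]
    where [d_k = c_(i+1+k)].  Summation by parts turns this into
    [d_0 + sum_k r^(k+1) (d_(k+1) - d_k)], whose terms are nondecreasing in
    [r >= 0] because [d] is nondecreasing; and [r] decreases with [lambda]. *)

Require Import Defs.
From Stdlib Require Import Reals Lra Lia.
From Coquelicot Require Import Coquelicot.
Open Scope R_scope.

(** The new series is the shifted original minus [r] times the original, both convergent. This
    supplies the summability that the termwise comparison in [power_series_by_parts_le] requires. *)
Lemma ex_series_power_diff (d : nat -> R) (r : R) :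
  ex_series (fun k : nat => r ^ k * d k) ->
  ex_series (fun k : nat => r ^ S k * (d (S k) - d k)).
Proof.
  intros Hd.
  apply ex_series_ext with
    (fun k => minus (r ^ S k * d (S k)) (scal r (r ^ k * d k))).
  - intros k; unfold minus, plus, opp, scal; simpl; unfold mult; simpl; ring.
  - apply (ex_series_minus (V := R_NormedModule)).
    + exact (proj1 (ex_series_incr_1 (fun k => r ^ k * d k)) Hd).
    + now apply (ex_series_scal (V := R_NormedModule)).
Qed.

Lemma power_series_by_parts (d : nat -> R) (r : R) :
  ex_series (fun k : nat => r ^ k * d k) ->
  (1 - r) * Series (fun k : nat => r ^ k * d k) =
  d 0%nat + Series (fun k : nat => r ^ S k * (d (S k) - d k)).
Proof.
  intros Hd.
  rewrite (Series_ext (fun k => r ^ S k * (d (S k) - d k))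
    (fun k => r ^ S k * d (S k) - r * (r ^ k * d k)))
    by (intros k; simpl; ring).
  rewrite Series_minus.
  - rewrite Series_scal_l, Rmult_minus_distr_r, Rmult_1_l.
    (* Only the copy with coefficient 1 is split: its head is [d 0] and its tail the shifted series,
       while the copy multiplied by [r] stands on both sides and cancels. *)
    rewrite (Series_incr_1 (fun k => r ^ k * d k) Hd) at 1.
    simpl; ring.
  - exact (proj1 (ex_series_incr_1 (fun k => r ^ k * d k)) Hd).
  - now apply (ex_series_scal (V := R_NormedModule) r).
Qed.

Lemma power_series_by_parts_le (d : nat -> R) (r s : R) :
  (forall k : nat, d k <= d (S k)) ->
  0 <= r <= s ->
  ex_series (fun k : nat => r ^ k * d k) ->
  ex_series (fun k : nat => s ^ k * d k) ->
  (1 - r) * Series (fun k : nat => r ^ k * d k) <=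
  (1 - s) * Series (fun k : nat => s ^ k * d k).
Proof.
  intros d_incr Hrs Hr Hs.
  rewrite !power_series_by_parts by assumption.
  apply Rplus_le_compat_l, Series_le.
  - intros k; specialize (d_incr k); split.
    + apply Rmult_le_pos; [apply pow_le|]; lra.
    + apply Rmult_le_compat_r; [|apply pow_incr]; lra.
  - now apply ex_series_power_diff.
Qed.

(** Since [0 ^ 0 = 1], every partial sum equals [d 0]. Hence the separate value prescribed for
    [q = 0] agrees with the series, and [q > 0] and [q = 0] can be treated uniformly. *)
Lemma is_series_zero_pow (d : nat -> R) :
  is_series (fun k : nat => 0 ^ k * d k) (d 0%nat).
Proof.
  apply filterlim_ext with (fun _ : nat => d 0%nat); [|apply filterlim_const].
  intros n; symmetry; induction n as [|n IHn].
  - rewrite sum_O; simpl; ring.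
  - rewrite sum_Sn, IHn; unfold plus; simpl; ring.
Qed.

Lemma C_disc_Series (c : nat -> R) (beta : R) (i : nat) (q : R) :
  0 <= q ->
  C_disc c beta i q = Series (fun k : nat => (beta * q) ^ k * c (i + k)%nat).
Proof.
  intros Hq; unfold C_disc.
  destruct (Rlt_dec 0 q); [reflexivity|].
  replace q with 0 by lra.
  rewrite Rmult_0_r; symmetry; apply is_series_unique.
  replace (c i) with (c (i + 0)%nat) by (f_equal; lia).
  apply (is_series_zero_pow (fun k => c (i + k)%nat)).
Qed.

Lemma C_avg_C_disc (c : nat -> R) (i : nat) (q : R) :
  C_avg c i q = C_disc c 1 i q.
Proof. unfold C_avg, C_disc; now rewrite Rmult_1_l. Qed.

(** For [q > 0], dropping the first [i] terms leaves a series starting at [c (i + 1) * q ^ (i + 1)],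
    and dividing by [q ^ (i + 1)] normalizes it. For [q = 0] this division is impossible, but only
    the term [k = 0] survives. *)
Lemma ex_series_shifted_costs (c : nat -> R) (i : nat) (q : R) :
  0 <= q ->
  ex_series (fun k : nat => c (k + 1)%nat * q ^ (k + 1)) ->
  ex_series (fun k : nat => q ^ k * c (i + 1 + k)%nat).
Proof.
  intros [q_gt0 | <-] Hc; [|eexists; apply is_series_zero_pow].
  apply (ex_series_incr_n _ i) in Hc.
  apply (ex_series_scal (V := R_NormedModule) (/ q ^ (i + 1))) in Hc.
  revert Hc; apply ex_series_ext; intros k.
  change (/ q ^ (i + 1) * (c (i + k + 1)%nat * q ^ (i + k + 1)) =
          q ^ k * c (i + 1 + k)%nat).
  replace (i + k + 1)%nat with (i + 1 + k)%nat by lia.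
  rewrite (pow_add q (i + 1)).
  field; apply pow_nonzero; lra.
Qed.

Lemma ex_series_discounted (d : nat -> R) (beta q : R) :
  (forall k : nat, 0 <= d k) -> 0 <= beta <= 1 -> 0 <= q ->
  ex_series (fun k : nat => q ^ k * d k) ->
  ex_series (fun k : nat => (beta * q) ^ k * d k).
Proof.
  intros d_ge0 Hbeta Hq.
  apply (ex_series_le (V := R_CompleteNormedModule)); intros k.
  change (Rabs ((beta * q) ^ k * d k) <= q ^ k * d k).
  assert (0 <= beta * q <= q) by nra.
  rewrite Rabs_pos_eq.
  - now apply Rmult_le_compat_r; [|apply pow_incr].
  - apply Rmult_le_pos; [apply pow_le; lra | easy].
Qed.

(** This is the only part of either index that varies with [lam]. The range of [beta] includes 1 so
    that the average criterion is covered too. *)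
Lemma normalized_cost_nonincreasing (c : nat -> R) (mu beta : R) (i : nat) :
  (forall j : nat, (1 <= j)%nat -> 0 <= c j) ->
  (forall j k : nat, (1 <= j)%nat -> (j <= k)%nat -> c j <= c k) ->
  0 < mu <= 1 -> 0 <= beta <= 1 ->
  nonincreasing_on (admissible c mu)
    (fun lam => (1 - beta * (1 - lam * mu)) *
                C_disc c beta (i + 1) (1 - lam * mu)).
Proof.
  intros c_ge0 c_incr Hmu Hbeta x y [Hx Sx] [Hy Sy] Hxy.
  assert (0 <= 1 - x * mu) by nra.
  assert (0 <= 1 - y * mu) by nra.
  assert (1 - y * mu <= 1 - x * mu) by nra.
  rewrite !C_disc_Series by assumption.
  apply (power_series_by_parts_le (fun k => c (i + 1 + k)%nat)).
  - intros k; apply c_incr; lia.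
  - nra.
  - apply (ex_series_discounted (fun k => c (i + 1 + k)%nat));
      [intros k; apply c_ge0; lia | easy | easy |].
    now apply ex_series_shifted_costs.
  - apply (ex_series_discounted (fun k => c (i + 1 + k)%nat));
      [intros k; apply c_ge0; lia | easy | easy |].
    now apply ex_series_shifted_costs.
Qed.

Lemma nonincreasing_on_affine (D : R -> Prop) (f g : R -> R) (a b : R) :
  0 <= a -> (forall x, g x = a * f x + b) ->
  nonincreasing_on D f -> nonincreasing_on D g.
Proof.
  intros Ha Hg Hf x y Dx Dy Hxy.
  rewrite !Hg.
  now apply Rplus_le_compat_r, Rmult_le_compat_l; [|apply Hf].
Qed.

Theorem proposition5 (c : nat -> R) (mu beta : R) (i : nat)
  (c_nonneg : forall j : nat, (1 <= j)%nat -> 0 <= c j)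
  (c_nondecr : forall j k : nat, (1 <= j)%nat -> (j <= k)%nat -> c j <= c k)
  (mu_range : 0 < mu <= 1)
  (beta_range : 0 < beta < 1)
  (i_ge1 : (1 <= i)%nat) :
  nonincreasing_on (admissible c mu) (whittle_disc c beta mu i) /\
  nonincreasing_on (admissible c mu) (whittle_avg c mu i).
Proof.
  split.
  - apply nonincreasing_on_affine with
      (* The factor [1 - beta * q] stays with [C_disc]; the rest of the prefactor and the finite sum
         of past costs are constant in [lam]. *)
      (a := mu * (beta * (1 - beta ^ i) / (1 - beta)))
      (b := - (mu * sum_n_m (fun j => beta ^ j * c j) 1 i))
      (3 := normalized_cost_nonincreasing c mu beta i c_nonneg c_nondecr
              mu_range ltac:(lra)).
    + assert (beta ^ i <= 1) by (rewrite <- (pow1 i); apply pow_incr; lra).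
      apply Rmult_le_pos; [lra|].
      apply Rdiv_le_0_compat; nra.
    + intros lam; unfold whittle_disc; field; lra.
  - apply nonincreasing_on_affine with
      (* At [beta = 1] the normalizing factor [1 - q] is exactly [p = lam * mu], so only
         [mu * INR i] remains outside. *)
      (a := mu * INR i) (b := - (mu * sum_n_m c 1 i))
      (3 := normalized_cost_nonincreasing c mu 1 i c_nonneg c_nondecr
              mu_range ltac:(lra)).
    + apply Rmult_le_pos; [lra | apply pos_INR].
    + intros lam; unfold whittle_avg; rewrite C_avg_C_disc; ring.
Qed.
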